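(* Let $\lambda\neq 0$ and let $F(t)=\frac{1}{(1+t)^\lambda-1}$, considered for $t>-1$, $t\neq 0$. Define numbers $a_j(N)$ for $N\ge 0$ and $0\le j\le N$ by $a_0(0)=\frac{1}{\lambda}$, $a_0(N)=(N+\lambda-1)_{N-1}$ for $N\ge 1$, and, for $N\ge 1$ and $j=1,2,\ldots,N$ (recursively in $j$), $$a_j(N)=j\lambda\sum_{i=0}^{N-j}(N+(j+1)\lambda-1)_i\,a_{j-1}(N-i-1).$$ Then for every $N\ge 0$, $F$ satisfies the nonlinear differential equation $$F^{(N)}=\frac{(-1)^N\lambda}{(1+t)^N}\sum_{i=1}^{N+1}a_{i-1}(N)\,F^i .$$
   Context: $(x)_n$ denotes the falling factorial $x(x-1)\cdots(x-n+1)$, with $(x)_0=1$. $(1+t)^\lambda=e^{\lambda\log(1+t)}$ for $t>-1$. $F^{(N)}$ denotes the $N$-th derivative of $F$ with respect to $t$. *)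

(* Defs.v *)
From Stdlib Require Import Reals.
From Coquelicot Require Import Coquelicot.
Open Scope R_scope.

Fixpoint falling (x : R) (n : nat) : R :=
  match n with
  | O => 1
  | S m => falling x m * (x - INR m)
  end.

(* [a lambda j N] is a_j(N).  Only 0 <= j <= N is meaningful; for such arguments
   every recursive call again satisfies j - 1 <= N - i - 1, so neither truncated
   subtraction nor values outside the range are involved. *)
Fixpoint a (lambda : R) (j N : nat) {struct j} : R :=
  match j with
  | O =>
      match N with
      | O => 1 / lambda
      | S _ => falling (INR N + lambda - 1) (N - 1)
      end
  | S j' =>
      INR j * lambda *
      sum_n_m (fun i => falling (INR N + (INR j + 1) * lambda - 1) i
                        * a lambda j' (N - i - 1)) 0 (N - j)
  end.

Definition F (lambda t : R) : R := 1 / (Rpower (1 + t) lambda - 1).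

(* Main.v *)
Require Import Defs.
From Stdlib Require Import Reals Lra Lia.
From Coquelicot Require Import Coquelicot.
Open Scope R_scope.

(** Since [(1+t)^lambda = 1 + 1/F], one has [F' = - lambda / (1+t) * (F + F^2)].
    Differentiating the claimed formula for [F^(N)] therefore reproduces it at
    [N+1] provided that
    [a_j(N+1) = (N + (j+1) lambda) a_j(N) + j lambda a_(j-1)(N)], with the
    convention [a_(N+1)(N) = 0]. The closed sums defining [a_j(N)] satisfy this
    recurrence because [(x+1)_(n+1) = (x+1) (x)_n]. *)

Lemma falling_S_left (x : R) (n : nat) :
  falling (x + 1) (S n) = (x + 1) * falling x n.
Proof.
  induction n as [|n IH].
  - simpl; ring.
  - change (falling (x + 1) (S n) * (x + 1 - INR (S n)) =
            (x + 1) * (falling x n * (x - INR n))).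
    rewrite IH, S_INR; ring.
Qed.

(** For N = 0 both sides are 1, since lambda * (1 / lambda) = 1: the exceptional value a_0(0) is the
    one that fits the recurrence. Later cases come from [falling_S_left]. *)
Lemma a_0_S (lambda : R) (N : nat) : lambda <> 0 ->
  a lambda 0 (S N) = (INR N + lambda) * a lambda 0 N.
Proof.
  intros Hl; destruct N as [|N].
  - simpl; field; exact Hl.
  - change (falling (INR (S (S N)) + lambda - 1) (S N) =
            (INR (S N) + lambda) * falling (INR (S N) + lambda - 1) (S N - 1)).
    replace (S N - 1)%nat with N by lia.
    replace (INR (S (S N)) + lambda - 1) with (INR (S N) + lambda - 1 + 1)
      by (rewrite (S_INR (S N)); ring).
    rewrite falling_S_left; ring.
Qed.

Lemma a_S_unfold (lambda : R) (j N : nat) :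
  a lambda (S j) N =
  INR (S j) * lambda *
  sum_n_m (fun i => falling (INR N + (INR (S j) + 1) * lambda - 1) i
                    * a lambda j (N - i - 1)) 0 (N - S j).
Proof. reflexivity. Qed.

(** Top case j = N + 1 of the recurrence, kept apart because [a] itself does not follow the
    convention a_(N+1)(N) = 0: truncated subtraction leaves one term in the sum, and [a lambda 1 0]
    is 1 when [lambda <> 0]. *)
Lemma a_diag (lambda : R) (N : nat) :
  a lambda (S N) (S N) = INR (S N) * lambda * a lambda N N.
Proof.
  rewrite a_S_unfold.
  replace (S N - S N)%nat with 0%nat by lia.
  rewrite sum_n_n.
  replace (S N - 0 - 1)%nat with N by lia.
  simpl falling; ring.
Qed.

Lemma a_S_S (lambda : R) (j N : nat) : (S j <= N)%nat ->
  a lambda (S j) (S N) =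
  (INR N + (INR (S j) + 1) * lambda) * a lambda (S j) N
  + INR (S j) * lambda * a lambda j N.
Proof.
  intros Hj.
  rewrite !a_S_unfold.
  replace (S N - S j)%nat with (S (N - S j)) by lia.
  (* The term i = 0 yields the part with [a lambda j N]; from the others, shifted by one,
     [falling_S_left] extracts the common factor [INR N + c]. *)
  rewrite sum_Sn_m by lia.
  rewrite <- sum_n_m_S.
  set (c := (INR (S j) + 1) * lambda).
  rewrite (sum_n_m_ext _
    (fun i => mult (INR N + c)
       (falling (INR N + c - 1) i * a lambda j (N - i - 1)))).
  - rewrite sum_n_m_mult_l.
    replace (S N - 0 - 1)%nat with N by lia.
    set (s := sum_n_m (fun i => falling (INR N + c - 1) i * a lambda j (N - i - 1))
                0 (N - S j)).
    change (INR (S j) * lambda * (1 * a lambda j N + (INR N + c) * s) =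
            (INR N + c) * (INR (S j) * lambda * s)
            + INR (S j) * lambda * a lambda j N).
    ring.
  - intros i.
    replace (S N - S i - 1)%nat with (N - i - 1)%nat by lia.
    replace (INR (S N) + c - 1) with (INR N + c - 1 + 1)
      by (rewrite S_INR; ring).
    rewrite falling_S_left.
    replace (INR N + c - 1 + 1) with (INR N + c) by ring.
    apply Rmult_assoc.
Qed.

(** Cutting the sums at M <= N keeps the induction on M within the range of [a_S_S]. The subtracted
    term is the [x ^ 2] contribution of index M, which belongs to index M + 1, beyond the cut. *)
Lemma a_partial_sum_S (lambda x : R) (N M : nat) : lambda <> 0 -> (M <= N)%nat ->
  sum_f_R0 (fun i => a lambda i (S N) * x ^ S i) M =
  INR N * sum_f_R0 (fun i => a lambda i N * x ^ S i) M
  + lambda * (x + x ^ 2) * sum_f_R0 (fun i => a lambda i N * (INR (S i) * x ^ i)) M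
  - lambda * INR (S M) * a lambda M N * x ^ S (S M).
Proof.
  intros Hl; induction M as [|M IH]; intros HM.
  - cbn [sum_f_R0]; rewrite a_0_S by exact Hl; simpl (INR 1); ring.
  - cbn [sum_f_R0]; rewrite IH, a_S_S by lia.
    rewrite !(S_INR (S M)), <- !tech_pow_Rmult; ring.
Qed.

(** The top term, given by [a_diag], cancels the term subtracted in [a_partial_sum_S]. The last sum
    is the derivative in x of the sum before it, as the chain rule will produce at x = F(t). *)
Lemma a_sum_S (lambda x : R) (N : nat) : lambda <> 0 ->
  sum_f_R0 (fun i => a lambda i (S N) * x ^ S i) (S N) =
  INR N * sum_f_R0 (fun i => a lambda i N * x ^ S i) N
  + lambda * (x + x ^ 2) * sum_f_R0 (fun i => a lambda i N * (INR (S i) * x ^ i)) N.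
Proof.
  intros Hl; cbn [sum_f_R0].
  rewrite a_partial_sum_S, a_diag by (exact Hl || lia); ring.
Qed.

Lemma Rpower_1p_neq_1 (lambda t : R) : lambda <> 0 -> -1 < t -> t <> 0 ->
  Rpower (1 + t) lambda - 1 <> 0.
Proof.
  intros Hl Ht Ht0 H.
  assert (He : exp (lambda * ln (1 + t)) = exp 0)
    by (rewrite exp_0; unfold Rpower in H; lra).
  apply exp_inv, Rmult_integral in He; destruct He as [He|He]; [easy|].
  rewrite <- ln_1 in He; apply ln_inv in He; lra.
Qed.

Lemma is_derive_F (lambda t : R) : lambda <> 0 -> -1 < t -> t <> 0 ->
  is_derive (F lambda) t
    (- lambda / (1 + t) * (F lambda t + F lambda t ^ 2)).
Proof.
  intros Hl Ht Ht0.
  pose proof (Rpower_1p_neq_1 lambda t Hl Ht Ht0) as Hn.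
  unfold F, Rpower in *.
  auto_derive.
  - repeat split; lra.
  - field; repeat split; lra.
Qed.

Lemma is_derive_sum_pow (f : R -> R) (c : nat -> R) (N : nat) (t l : R) :
  is_derive f t l ->
  is_derive (fun y => sum_f_R0 (fun i => c i * f y ^ S i) N) t
    (l * sum_f_R0 (fun i => c i * (INR (S i) * f t ^ i)) N).
Proof.
  intros Hf.
  assert (Hterm : forall i,
    is_derive (fun y => c i * f y ^ S i) t (l * (c i * (INR (S i) * f t ^ i)))).
  { intros i.
    replace (l * _) with (c i * (INR (S i) * l * f t ^ pred (S i)))
      by (simpl pred; ring).
    apply (is_derive_scal (fun y => f y ^ S i)), is_derive_pow, Hf. }
  induction N as [|N IH].
  - apply Hterm.
  - cbn [sum_f_R0]; rewrite Rmult_plus_distr_l.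
    apply (is_derive_plus (V := R_NormedModule)); [exact IH | apply Hterm].
Qed.

Lemma is_derive_n_F (lambda : R) (N : nat) (t : R) :
  lambda <> 0 -> -1 < t -> t <> 0 ->
  is_derive_n (F lambda) N t
    ((-1) ^ N * lambda / (1 + t) ^ N
     * sum_f_R0 (fun i => a lambda i N * F lambda t ^ S i) N).
Proof.
  intros Hl; revert t; induction N as [|N IH]; intros t Ht Ht0.
  - simpl; field; exact Hl.
  - cbn [is_derive_n].
    (* Differentiating once more needs the formula for the N-th derivative near t, not only at t;
       the conditions -1 < y and y <> 0 are open. *)
    apply (is_derive_ext_loc (fun y => (-1) ^ N * lambda / (1 + y) ^ N
      * sum_f_R0 (fun i => a lambda i N * F lambda y ^ S i) N)).
    { apply (filter_imp (fun y => -1 < y /\ y <> 0)).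
      - intros y [Hy Hy0]; symmetry; apply is_derive_n_unique, IH; assumption.
      - apply filter_and.
        + exact (open_gt (-1) t Ht).
        + exact (open_neq 0 t Ht0). }
    pose proof (is_derive_sum_pow (F lambda) (fun i => a lambda i N) N t _
                  (is_derive_F lambda t Hl Ht Ht0)) as Hsum.
    assert (Hp : (1 + t) ^ N <> 0) by (apply pow_nonzero; lra).
    assert (Hpre : is_derive (fun y => (-1) ^ N * lambda / (1 + y) ^ N) t
              ((-1) ^ S N * lambda / (1 + t) ^ S N * INR N)).
    { auto_derive; [exact Hp|].
      (* The computed derivative contains the exponent [pred N], so N = 0 is treated apart. *)
      destruct N as [|N].
      - simpl; field; lra.
      - rewrite <- !tech_pow_Rmult in *; simpl pred.
        field; split; [apply pow_nonzero|]; lra. }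
    pose proof (is_derive_mult _ _ t _ _ Hpre Hsum Rmult_comm) as H.
    (* Only the equality of the product-rule value with the claimed one remains. *)
    refine (@eq_ind R _ (is_derive _ t) H _ _).
    rewrite a_sum_S by exact Hl.
    change plus with Rplus; change mult with Rmult.
    rewrite <- !tech_pow_Rmult.
    field; split; [exact Hp | lra].
Qed.

Theorem theorem2 (lambda : R) (hlambda : lambda <> 0) (N : nat)
    (t : R) (ht : -1 < t) (ht0 : t <> 0) :
  is_derive_n (F lambda) N t
    ((-1) ^ N * lambda / (1 + t) ^ N
     * sum_n_m (fun i => a lambda (i - 1) N * F lambda t ^ i) 1 (N + 1)).
Proof.
  replace (N + 1)%nat with (S N) by lia.
  rewrite <- sum_n_m_S.
  rewrite (sum_n_m_ext _ (fun i => a lambda i N * F lambda t ^ S i))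
    by (intros i; replace (S i - 1)%nat with i by lia; reflexivity).
  fold (sum_n (fun i => a lambda i N * F lambda t ^ S i) N).
  rewrite sum_n_Reals.
  apply is_derive_n_F; assumption.
Qed.
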